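(* Let $k$ be a field, let $M=\begin{pmatrix} a & b\\ c & d\end{pmatrix} \in \mathrm{GL}(2,\mathbb{Z})$, and let $\sigma$ be the $k$-algebra automorphism of $k[x^{\pm 1},y^{\pm 1}]$ defined by $\sigma(x)=x^ay^b$ and $\sigma(y)=x^cy^d$. Then $k[x^{\pm 1},y^{\pm 1}][t;\sigma]$ contains a free subalgebra if and only if the spectral radius of $M$ is $>1$. In that case, $k\{xt^{2n},yt^{2n}\}$ is a free subalgebra of $k[x^{\pm 1},y^{\pm 1}][t;\sigma]$ for all natural numbers $n$ such that the spectral radius of $M^{2n}$ is $\ge 2$.
   Context: For a commutative $k$-algebra $R$ and a $k$-algebra automorphism $\sigma$ of $R$, the skew polynomial ring $R[t;\sigma]$ is the $k$-algebra generated by $R$ and an indeterminate $t$, free as a left $R$-module with basis $\{t^n \mid n \ge 0\}$, with multiplication determined by $t^n r=\sigma^n(r)t^n$ for all $r\in R$, $n\ge 0$. For elements $u,v$ of a $k$-algebra, $k\{u,v\}$ denotes the $k$-subalgebra they generate. ''Free subalgebra'' means a $k$-subalgebra that is a free associative $k$-algebra on $\ge 2$ variables; $k\{u,v\}$ being free means that $u$ and $v$ are free generators of it. The ring $k[x^{\pm 1},y^{\pm 1}]$ is the commutative Laurent polynomial ring. *)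

(* Defs.v *)
From HB Require Import structures.
From mathcomp Require Import all_boot all_order all_algebra all_field.
From mathcomp Require Import finmap.
From mathcomp Require Import boolp classical_sets.
From mathcomp Require Import monalg.

Set Implicit Arguments.
Unset Strict Implicit.
Unset Printing Implicit Defensive.

Import Order.TTheory GRing.Theory Num.Theory.

Local Open Scope ring_scope.

(* The library's [{malg k[K]}] is only a ring when [K] is a [monomType], i.e.
   a monoid without nontrivial invertible elements.  The group algebra is
   therefore a new carrier, reusing the module structure of [{malg k[A]}]:
   [<< c *g a >>] is c times the basis element indexed by [a : A]. *)
Definition grpalg (k : comNzRingType) (A : zmodType) : Type := {malg k[A]}.

Section GroupAlgebra.
Context (k : comNzRingType) (A : zmodType).

HB.instance Definition _ := GRing.Lmodule.copy (grpalg k A) {malg k[A]}.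

Implicit Types (f g h : grpalg k A).

Definition gone : grpalg k A := << 1 *g 0 >>.

Definition gmul f g : grpalg k A :=
  \sum_(a <- msupp f) \sum_(b <- msupp g) << f@_a * g@_b *g a + b >>.

Lemma gmulw (d1 d2 : {fset A}) f g :
  (msupp f `<=` d1)%fset -> (msupp g `<=` d2)%fset ->
  gmul f g = \sum_(a <- d1) \sum_(b <- d2) << f@_a * g@_b *g a + b >>.
Proof.
move=> le1 le2; rewrite /gmul (big_fset_incl _ le1) /=.
  apply/eq_bigr=> a _; apply/big_fset_incl => // b _ /mcoeff_outdom ->.
  by rewrite mulr0 monalgU0.
move=> a _ /mcoeff_outdom fa0.
by rewrite big1 => // b _; rewrite fa0 mul0r monalgU0.
Qed.

Lemma gmulC : commutative gmul.
Proof.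
move=> f g; rewrite /gmul exchange_big; apply: eq_bigr => a _.
by apply: eq_bigr => b _; rewrite mulrC addrC.
Qed.

Lemma gmulDl : left_distributive gmul +%R.
Proof.
move=> f1 f2 g.
rewrite [in RHS](gmulw (fsubsetUl _ (msupp f2)) (fsubset_refl _)).
rewrite [in RHS](gmulw (fsubsetUr (msupp f1) _) (fsubset_refl _)).
rewrite (gmulw (msuppD_le _ _) (fsubset_refl _)).
rewrite -big_split /=; apply/eq_bigr=> a _.
rewrite -big_split /=; apply/eq_bigr=> b _.
by rewrite mcoeffD mulrDl monalgUD.
Qed.

Lemma gmulDr : right_distributive gmul +%R.
Proof. by move=> f g1 g2; rewrite gmulC gmulDl !(gmulC f). Qed.

Lemma gmul0g : left_zero 0 gmul.
Proof. by move=> g; rewrite /gmul msupp0 big_seq_fset0. Qed.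

Lemma gmulg0 : right_zero 0 gmul.
Proof. by move=> g; rewrite gmulC gmul0g. Qed.

Lemma gmulUU c1 c2 (a b : A) :
  gmul << c1 *g a >> << c2 *g b >> = << c1 * c2 *g a + b >>.
Proof.
by rewrite (gmulw msuppU_le msuppU_le) !big_seq_fset1 !mcoeffUU.
Qed.

Lemma grpalg_ind (P : grpalg k A -> Prop) :
  P 0 -> (forall f g, P f -> P g -> P (f + g)) ->
  (forall c (a : A), P << c *g a >>) -> forall f, P f.
Proof. by move=> P0 PD PU f; rewrite (monalgE f); apply: big_ind. Qed.

Lemma gmulA : associative gmul.
Proof.
move=> f g h; elim/grpalg_ind: f => [|f1 f2 IH1 IH2|c1 a1].
- by rewrite !gmul0g.
- by rewrite !gmulDl IH1 IH2.
elim/grpalg_ind: g => [|g1 g2 IH1 IH2|c2 a2].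
- by rewrite gmul0g gmulg0 gmul0g.
- by rewrite gmulDl !gmulDr gmulDl IH1 IH2.
elim/grpalg_ind: h => [|h1 h2 IH1 IH2|c3 a3].
- by rewrite !gmulg0.
- by rewrite !gmulDr IH1 IH2.
by rewrite !gmulUU mulrA addrA.
Qed.

Lemma gmul1g : left_id gone gmul.
Proof.
move=> g; elim/grpalg_ind: g => [|g1 g2 IH1 IH2|c a].
- by rewrite gmulg0.
- by rewrite gmulDr IH1 IH2.
by rewrite gmulUU mul1r add0r.
Qed.

Lemma gone_neq0 : gone != 0.
Proof. by rewrite monalgU_eq0 oner_neq0. Qed.

HB.instance Definition _ := GRing.Zmodule_isComNzRing.Build (grpalg k A)
  gmulA gmulC gmul1g gmulDl gone_neq0.

Lemma gscaleU c d (a : A) :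
  c *: (<< d *g a >> : grpalg k A) = << c * d *g a >>.
Proof. by apply/malgP => b; rewrite mcoeffZ !mcoeffU mulrnAr. Qed.

Lemma gscaleAl (c : k) f g : c *: (f * g) = (c *: f) * g.
Proof.
have cE h : c *: h = (<< c *g 0 >> : grpalg k A) * h.
  elim/grpalg_ind: h => [|h1 h2 IH1 IH2|d a].
  - by rewrite scaler0 mulr0.
  - by rewrite scalerDr mulrDr IH1 IH2.
  by rewrite gscaleU -[_ * _ in RHS]/(gmul _ _) gmulUU add0r.
by rewrite !cE mulrA.
Qed.

HB.instance Definition _ :=
  GRing.Lmodule_isLalgebra.Build k (grpalg k A) gscaleAl.
HB.instance Definition _ := GRing.Lalgebra_isComAlgebra.Build k (grpalg k A).

Definition gunit : {pred grpalg k A} := fun f => `[< exists g, g * f = 1 >].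

Definition ginv f : grpalg k A :=
  if pselect (exists g, g * f = 1) is left ex then projT1 (cid ex) else f.

Lemma ginvV : {in gunit, left_inverse 1 ginv *%R}.
Proof.
move=> f /asboolP exf; rewrite /ginv; case: pselect => // ex.
by case: (cid ex).
Qed.

Lemma gunitP f g : g * f = 1 -> gunit f.
Proof. by move=> gf1; apply/asboolP; exists g. Qed.

Lemma ginv_out : {in [predC gunit], ginv =1 id}.
Proof.
by move=> f; rewrite inE => /asboolP nex; rewrite /ginv; case: pselect.
Qed.

HB.instance Definition _ :=
  GRing.ComNzRing_hasMulInverse.Build (grpalg k A) ginvV gunitP ginv_out.

Definition gmon (a : A) : grpalg k A := << 1 *g a >>.

Lemma gmonD a b : gmon (a + b) = gmon a * gmon b.
Proof. by rewrite -[_ * _]/(gmul _ _) gmulUU mulr1. Qed.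

Lemma gmon0 : gmon 0 = 1. Proof. by []. Qed.

Lemma gmon_unit a : gmon a \is a GRing.unit.
Proof. by apply/unitrP; exists (gmon (- a)); rewrite -!gmonD addNr subrr. Qed.

Lemma gmonN a : gmon (- a) = (gmon a)^-1.
Proof.
by apply: (mulIr (gmon_unit a)); rewrite mulVr ?gmon_unit // -gmonD addNr.
Qed.

Lemma gmonMz a (n : int) : gmon (a *~ n) = gmon a ^ n.
Proof.
have H (m : nat) : gmon (a *+ m) = gmon a ^+ m.
  by elim: m => [|m IHm]; rewrite ?mulr0n // mulrS gmonD exprS IHm.
by case: n => m; rewrite ?NegzE ?mulrNz ?exprnN ?gmonN -?pmulrn H.
Qed.

Lemma grpalgE f : f = \sum_(a <- msupp f) f@_a *: gmon a.
Proof.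
by rewrite [LHS]monalgE; apply: eq_bigr => a _; rewrite gscaleU mulr1.
Qed.

End GroupAlgebra.

Section GroupAlgebraMap.
Context (k : comNzRingType) (A B : zmodType) (h : {additive A -> B}).

Definition grpalg_map : grpalg k A -> grpalg k B :=
  mmap (in_alg (grpalg k B)) (fun a => gmon k (h a)).

Lemma grpalg_mapU c (a : A) :
  grpalg_map << c *g a >> = c *: gmon k (h a).
Proof. by rewrite /grpalg_map mmapU /= -scalerAl mul1r. Qed.

Lemma grpalg_map_is_additive : additive grpalg_map.
Proof. exact: mmap_is_additive. Qed.

HB.instance Definition _ :=
  GRing.isAdditive.Build (grpalg k A) (grpalg k B) grpalg_map
    grpalg_map_is_additive.

Lemma grpalg_map_is_multiplicative : multiplicative grpalg_map.
Proof.
split=> [f g|]; last by rewrite grpalg_mapU raddf0 gmon0 scale1r.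
elim/grpalg_ind: f => [|f1 f2 IH1 IH2|c a].
- by rewrite mul0r !raddf0 mul0r.
- by rewrite mulrDl !raddfD /= IH1 IH2 mulrDl.
elim/grpalg_ind: g => [|g1 g2 IH1 IH2|d b].
- by rewrite mulr0 !raddf0 mulr0.
- by rewrite mulrDr !raddfD /= IH1 IH2 mulrDr.
rewrite -[_ * _ in LHS]/(gmul _ _) gmulUU !grpalg_mapU raddfD gmonD.
by rewrite -scalerAl -scalerAr scalerA.
Qed.

HB.instance Definition _ :=
  GRing.isMultiplicative.Build (grpalg k A) (grpalg k B) grpalg_map
    grpalg_map_is_multiplicative.

Lemma grpalg_map_is_scalable : scalable grpalg_map.
Proof.
move=> c f; elim/grpalg_ind: f => [|f g IH1 IH2|d a].
- by rewrite scaler0 raddf0 scaler0.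
- by rewrite !raddfD /= IH1 IH2.
by rewrite gscaleU !grpalg_mapU scalerA.
Qed.

HB.instance Definition _ :=
  GRing.isScalable.Build k (grpalg k A) (grpalg k B) *:%R grpalg_map
    grpalg_map_is_scalable.

Lemma grpalg_map_gmon a : grpalg_map (gmon k a) = gmon k (h a).
Proof. by rewrite grpalg_mapU scale1r. Qed.

End GroupAlgebraMap.

(* k[x^+-1, y^+-1], the basis element indexed by (i, j) being x^i y^j. *)
Definition laurent (k : comNzRingType) : Type := grpalg k (int * int)%type.

HB.instance Definition _ (k : comNzRingType) :=
  GRing.ComUnitAlgebra.on (laurent k).

Definition lau_x (k : comNzRingType) : laurent k := gmon k (1, 0).
Definition lau_y (k : comNzRingType) : laurent k := gmon k (0, 1).

Lemma lau_monE (k : comNzRingType) (i j : int) :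
  gmon k (i, j) = lau_x k ^ i * lau_y k ^ j.
Proof.
have pE m (u : int * int) : u *~ m = (u.1 *~ m, u.2 *~ m).
  have H n : u *+ n = (u.1 *+ n, u.2 *+ n).
    by elim: n => [|n IHn]; rewrite ?mulr0n // !mulrS IHn; case: (u).
  by case: m => n; rewrite ?NegzE ?mulrNz -!pmulrn H.
rewrite -!gmonMz -gmonD !pE /= !mul0rz !intz.
by rewrite -[(i, 0) + (0, j)]/(i + 0, 0 + j) addr0 add0r.
Qed.

Lemma lau_x_unit (k : comNzRingType) : lau_x k \is a GRing.unit.
Proof. exact: gmon_unit. Qed.

Lemma lau_y_unit (k : comNzRingType) : lau_y k \is a GRing.unit.
Proof. exact: gmon_unit. Qed.

Section MonomialAutomorphism.
Variable M : 'M[int]_2.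

Definition mon_act (u : int * int) : int * int :=
  (u.1 * M 0 0 + u.2 * M 1 0, u.1 * M 0 1 + u.2 * M 1 1).

Lemma mon_actE i j :
  mon_act (i, j) = (i * M 0 0 + j * M 1 0, i * M 0 1 + j * M 1 1).
Proof. by []. Qed.

Lemma mon_act_is_additive : additive mon_act.
Proof.
move=> [u1 u2] [v1 v2]; rewrite /mon_act /=.
rewrite -[RHS]/(_ - _, _ - _) !mulrBl !opprD.
by congr (_, _); rewrite addrACA.
Qed.

HB.instance Definition _ :=
  GRing.isAdditive.Build (int * int)%type (int * int)%type mon_act
    mon_act_is_additive.

End MonomialAutomorphism.

Lemma mon_act_comp (M N : 'M[int]_2) u :
  mon_act N (mon_act M u) = mon_act (M *m N) u.
Proof.
rewrite /mon_act /= !mxE !big_ord_recl !big_ord0 !addr0 /=.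
have -> : lift ord0 ord0 = 1 :> 'I_2 by exact: val_inj.
by congr (_, _); rewrite !mulrDl !mulrDr !mulrA addrACA.
Qed.

Lemma mon_act1 u : mon_act 1%:M u = u.
Proof. by case: u => i j; rewrite /mon_act !mxE /= !mulr1 !mulr0 addr0 add0r. Qed.

Lemma grpalg_map_cancel (k : comNzRingType) (A : zmodType)
    (h h' : {additive A -> A}) :
  cancel h h' -> cancel (@grpalg_map k A A h) (@grpalg_map k A A h').
Proof.
move=> hK f; elim/grpalg_ind: f => [|f g IH1 IH2|c a].
- by rewrite !raddf0.
- by rewrite !raddfD /= IH1 IH2.
by rewrite grpalg_mapU linearZ /= grpalg_map_gmon hK gscaleU mulr1.
Qed.

Lemma monomial_aut_ex (k : comNzRingType) (M : 'M[int]_2) : M \in unitmx ->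
  exists sigma : {lrmorphism laurent k -> laurent k},
    [/\ bijective sigma,
        sigma (lau_x k) = lau_x k ^ (M 0 0) * lau_y k ^ (M 0 1)
      & sigma (lau_y k) = lau_x k ^ (M 1 0) * lau_y k ^ (M 1 1)].
Proof.
move=> Mu; exists (@grpalg_map k _ _ (mon_act M)); split.
- exists (@grpalg_map k _ _ (mon_act (invmx M))); apply: grpalg_map_cancel => u.
    by rewrite /= mon_act_comp mulmxV // mon_act1.
  by rewrite /= mon_act_comp mulVmx // mon_act1.
- by rewrite [LHS]grpalg_map_gmon -lau_monE [X in gmon _ X = _]mon_actE !mul1r !mul0r !addr0.
- by rewrite [LHS]grpalg_map_gmon -lau_monE [X in gmon _ X = _]mon_actE !mul1r !mul0r !add0r.
Qed.

(* R[t; sigma]: a polynomial p in {poly R} stands for \sum_i p`_i t^i, with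
   coefficients on the left, and the product is twisted by t r = sigma(r) t. *)
Definition skew_poly (k : comNzRingType) (R : comAlgType k)
  (sigma : {lrmorphism R -> R}) : Type := {poly R}.

Section SkewPolynomials.
Context (k : comNzRingType) (R : comAlgType k) (sigma : {lrmorphism R -> R}).

HB.instance Definition _ := GRing.Zmodule.copy (skew_poly sigma) {poly R}.

Implicit Types (p q r : skew_poly sigma) (c d : R).

Definition smon c (n : nat) : skew_poly sigma := c *: 'X^n.

Definition sone : skew_poly sigma := smon 1 0.

Definition smul p q : skew_poly sigma :=
  \sum_(i < size (p : {poly R})) \sum_(j < size (q : {poly R}))
    smon ((p : {poly R})`_i * iter i sigma (q : {poly R})`_j) (i + j).

Definition sscale (a : k) p : skew_poly sigma := a%:A *: (p : {poly R}).

Lemma smon0 n : smon 0 n = 0. Proof. exact: scale0r. Qed.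

Lemma smonD c d n : smon (c + d) n = smon c n + smon d n.
Proof. exact: scalerDl. Qed.

Lemma iter_sigma0 n : iter n sigma 0 = 0.
Proof. by elim: n => //= n ->; rewrite rmorph0. Qed.

Lemma iter_sigmaD n : {morph iter n sigma : c d / c + d}.
Proof. by elim: n => //= n IHn c d /=; rewrite IHn rmorphD. Qed.

Lemma iter_sigmaM n : {morph iter n sigma : c d / c * d}.
Proof. by elim: n => //= n IHn c d /=; rewrite IHn rmorphM. Qed.

Lemma iter_sigma1 n : iter n sigma 1 = 1.
Proof. by elim: n => //= n ->; rewrite rmorph1. Qed.

Lemma iter_sigmaA n (a : k) : iter n sigma a%:A = a%:A.
Proof. by elim: n => //= n ->; rewrite linearZ /= rmorph1. Qed.

Lemma sum_ord_widen (V : zmodType) (F : nat -> V) (m n : nat) :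
  (m <= n)%N -> (forall i, (m <= i)%N -> F i = 0) ->
  \sum_(i < m) F i = \sum_(i < n) F i.
Proof.
move=> le_mn F0; rewrite (big_ord_widen n F le_mn) big_mkcond /=.
by apply: eq_bigr => i _; case: ltnP => // /F0.
Qed.

Lemma smulw (m n : nat) p q :
  (size (p : {poly R}) <= m)%N -> (size (q : {poly R}) <= n)%N ->
  smul p q = \sum_(i < m) \sum_(j < n)
    smon ((p : {poly R})`_i * iter i sigma (q : {poly R})`_j) (i + j).
Proof.
move=> le_pm le_qn; rewrite /smul (sum_ord_widen (F := fun i => \sum_(j < _)
  smon ((p : {poly R})`_i * iter i sigma (q : {poly R})`_j) (i + j)) le_pm).
  apply: eq_bigr => i _; apply: (sum_ord_widen (F := fun j =>
    smon ((p : {poly R})`_i * iter i sigma (q : {poly R})`_j) (i + j))) => // j.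
  by move=> le_qj; rewrite (nth_default _ le_qj) iter_sigma0 mulr0 smon0.
by move=> i le_pi; rewrite big1 // => j _; rewrite (nth_default _ le_pi) mul0r smon0.
Qed.

Lemma smulDl : left_distributive smul +%R.
Proof.
move=> p1 p2 q.
pose m := maxn (size (p1 : {poly R})) (size (p2 : {poly R})).
have le1 : (size (p1 : {poly R}) <= m)%N by exact: leq_maxl.
have le2 : (size (p2 : {poly R}) <= m)%N by exact: leq_maxr.
rewrite (smulw le1 (leqnn _)) (smulw le2 (leqnn _)).
rewrite (@smulw m _ (p1 + p2) q (size_polyD _ _) (leqnn _)).
rewrite -big_split; apply: eq_bigr => i _; rewrite -big_split.
by apply: eq_bigr => j _ /=; rewrite coefD mulrDl smonD.
Qed.

Lemma smulDr : right_distributive smul +%R.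
Proof.
move=> p q1 q2.
pose m := maxn (size (q1 : {poly R})) (size (q2 : {poly R})).
have le1 : (size (q1 : {poly R}) <= m)%N by exact: leq_maxl.
have le2 : (size (q2 : {poly R}) <= m)%N by exact: leq_maxr.
rewrite (smulw (leqnn _) le1) (smulw (leqnn _) le2).
rewrite (@smulw _ m p (q1 + q2) (leqnn _) (size_polyD _ _)).
rewrite -big_split; apply: eq_bigr => i _; rewrite -big_split.
by apply: eq_bigr => j _ /=; rewrite coefD iter_sigmaD mulrDr smonD.
Qed.

Lemma smul0p : left_zero 0 smul.
Proof.
by move=> p; apply: (addrI (smul 0 p)); rewrite -smulDl !addr0.
Qed.

Lemma smulp0 : right_zero 0 smul.
Proof.
by move=> p; apply: (addrI (smul p 0)); rewrite -smulDr !addr0.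
Qed.

Lemma smulUU c d (m n : nat) :
  smul (smon c m) (smon d n) = smon (c * iter m sigma d) (m + n).
Proof.
have le_smon b l : (size (smon b l : {poly R}) <= l.+1)%N.
  by rewrite (leq_trans (size_scale_leq _ _)) ?size_polyXn.
rewrite (smulw (le_smon c m) (le_smon d n)) (bigD1 ord_max) //=.
rewrite [X in _ + X]big1 => [|i /negPf ne_im]; last first.
  rewrite big1 // => j _; rewrite coefZ coefXn.
  by rewrite (_ : (i == m :> nat) = false) ?mulr0 ?mul0r ?smon0 -?ne_im.
rewrite addr0 (bigD1 ord_max) //= [X in _ + X]big1 => [|j /negPf ne_jn].
  by rewrite addr0 !coefZ !coefXn !eqxx !mulr1.
rewrite [X in iter _ _ X]coefZ coefXn.
by rewrite (_ : (j == n :> nat) = false) ?mulr0 ?iter_sigma0 ?mulr0 ?smon0 -?ne_jn.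
Qed.

Lemma skew_polyE p :
  p = \sum_(i < size (p : {poly R})) smon (p : {poly R})`_i i.
Proof. by rewrite -[LHS]coefK poly_def. Qed.

Lemma skew_poly_ind (P : skew_poly sigma -> Prop) :
  P 0 -> (forall p q, P p -> P q -> P (p + q)) ->
  (forall c n, P (smon c n)) -> forall p, P p.
Proof. by move=> P0 PD PU p; rewrite (skew_polyE p); apply: big_ind. Qed.

Lemma smulA : associative smul.
Proof.
move=> p q r; elim/skew_poly_ind: p => [|p1 p2 IH1 IH2|c m].
- by rewrite !smul0p.
- by rewrite !smulDl IH1 IH2.
elim/skew_poly_ind: q => [|q1 q2 IH1 IH2|d n].
- by rewrite smul0p smulp0 smul0p.
- by rewrite smulDl !smulDr smulDl IH1 IH2.
elim/skew_poly_ind: r => [|r1 r2 IH1 IH2|e l].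
- by rewrite !smulp0.
- by rewrite !smulDr IH1 IH2.
by rewrite !smulUU iter_sigmaM -iterD mulrA addnA.
Qed.

Lemma smul1p : left_id sone smul.
Proof.
elim/skew_poly_ind => [|p1 p2 IH1 IH2|c m].
- by rewrite smulp0.
- by rewrite smulDr IH1 IH2.
by rewrite smulUU mul1r.
Qed.

Lemma smulp1 : right_id sone smul.
Proof.
elim/skew_poly_ind => [|p1 p2 IH1 IH2|c m].
- by rewrite smul0p.
- by rewrite smulDl IH1 IH2.
by rewrite smulUU iter_sigma1 mulr1 addn0.
Qed.

Lemma sone_neq0 : sone != 0.
Proof. by rewrite /sone /smon expr0 scale1r oner_neq0. Qed.

HB.instance Definition _ := GRing.Zmodule_isNzRing.Build (skew_poly sigma)
  smulA smul1p smulp1 smulDl smulDr sone_neq0.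

Lemma sscaleA (a b : k) p : sscale a (sscale b p) = sscale (a * b) p.
Proof. by rewrite /sscale scalerA -scalerAl mul1r scalerA. Qed.

Lemma sscale1 : left_id 1 sscale.
Proof. by move=> p; rewrite /sscale !scale1r. Qed.

Lemma sscaleDr : right_distributive sscale +%R.
Proof. by move=> a p q; rewrite /sscale scalerDr. Qed.

Lemma sscaleDl p : {morph sscale^~ p : a b / a + b}.
Proof. by move=> a b; rewrite /sscale !scalerDl. Qed.

HB.instance Definition _ := GRing.Zmodule_isLmodule.Build k (skew_poly sigma)
  sscaleA sscale1 sscaleDr sscaleDl.

Lemma smonM c d (m n : nat) :
  smon c m * smon d n = smon (c * iter m sigma d) (m + n).
Proof. exact: smulUU. Qed.

Lemma sscaleU (a : k) c n : a *: smon c n = smon (a *: c) n.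
Proof.
by rewrite -[LHS]/(sscale _ _) /sscale /smon scalerA -scalerAl mul1r.
Qed.

Lemma sscaleAl (a : k) p q : a *: (p * q) = (a *: p) * q.
Proof.
have aE r : a *: r = smon a%:A 0 * r.
  elim/skew_poly_ind: r => [|r1 r2 IH1 IH2|c m].
  - by rewrite scaler0 mulr0.
  - by rewrite scalerDr mulrDr IH1 IH2.
  by rewrite sscaleU smonM add0n -scalerAl mul1r.
by rewrite !aE mulrA.
Qed.

HB.instance Definition _ :=
  GRing.Lmodule_isLalgebra.Build k (skew_poly sigma) sscaleAl.

Lemma sscaleAr (a : k) p q : a *: (p * q) = p * (a *: q).
Proof.
elim/skew_poly_ind: p => [|p1 p2 IH1 IH2|c m].
- by rewrite !mul0r scaler0.
- by rewrite !mulrDl scalerDr IH1 IH2.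
elim/skew_poly_ind: q => [|q1 q2 IH1 IH2|d n].
- by rewrite !(mulr0, scaler0).
- by rewrite !(mulrDr, scalerDr) IH1 IH2.
have -> : a *: smon d n = smon (a%:A * d) n by rewrite sscaleU -scalerAl mul1r.
rewrite !smonM sscaleU iter_sigmaM iter_sigmaA.
by rewrite mulrCA -scalerAl mul1r.
Qed.

HB.instance Definition _ :=
  GRing.Lalgebra_isAlgebra.Build k (skew_poly sigma) sscaleAr.

Definition sconst c : skew_poly sigma := smon c 0.
Definition svar : skew_poly sigma := smon 1 1.

Lemma sconst_is_additive : additive sconst.
Proof. by move=> c d; rewrite /sconst /smon scalerBl. Qed.

HB.instance Definition _ :=
  GRing.isAdditive.Build R (skew_poly sigma) sconst sconst_is_additive.

Lemma sconst_is_multiplicative : multiplicative sconst.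
Proof. by split=> // c d; rewrite smonM. Qed.

HB.instance Definition _ :=
  GRing.isMultiplicative.Build R (skew_poly sigma) sconst
    sconst_is_multiplicative.

Lemma sconst_is_scalable : scalable sconst.
Proof. by move=> a c; rewrite sscaleU. Qed.

HB.instance Definition _ :=
  GRing.isScalable.Build k R (skew_poly sigma) *:%R sconst sconst_is_scalable.

Lemma smonE c n : smon c n = sconst c * svar ^+ n.
Proof.
have -> : svar ^+ n = smon 1 n.
  by elim: n => // n IHn; rewrite exprS IHn smonM iter_sigma1 mulr1.
by rewrite smonM mulr1.
Qed.

Lemma svarX_sconst n c : svar ^+ n * sconst c = sconst (iter n sigma c) * svar ^+ n.
Proof.
have := smonE 1 n; rewrite rmorph1 mul1r => <-.
by rewrite !smonM mul1r mulr1 addn0.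
Qed.

End SkewPolynomials.

Local Open Scope classical_set_scope.

Section FreeSubalgebras.
Context (k : comNzRingType) (S : algType k).

Definition subalgebra (B : set S) : Prop :=
  [/\ B 1, forall (a : k) u v, B u -> B v -> B (a *: u + v)
    & forall u v, B u -> B v -> B (u * v)].

Definition gen_subalg (X : set S) : set S := smallest subalgebra X.

(* [{malg k[{fmonom I}]}] is the free associative k-algebra on I, with free
   generators [<< fmu i >>].  The family g freely generates B when the
   evaluation at g is an isomorphism from this algebra onto B. *)
Definition freely_generates (I : choiceType) (g : I -> S) (B : set S) : Prop :=
  exists phi : {lrmorphism {malg k[{fmonom I}]} -> S},
    [/\ forall i, phi << fmu i >> = g i, injective phi & range phi = B].

Definition free_subalgebra (B : set S) : Prop :=
  subalgebra B /\
  exists (I : choiceType) (g : I -> S),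
    (exists i j : I, i != j) /\ freely_generates g B.

Definition contains_free_subalgebra : Prop :=
  exists B : set S, free_subalgebra B.

Definition free_on_pair (u v : S) : Prop :=
  freely_generates (fun b : bool => if b then v else u)
    (gen_subalg [set u; v]).

End FreeSubalgebras.

Arguments contains_free_subalgebra {k} S.

(* Eigenvalues with multiplicity; the complex eigenvalues of an integer matrix
   are algebraic, so they may be taken in [algC]. *)
Definition spectrum (n : nat) (A : 'M[algC]_n) : seq algC :=
  sval (closed_field_poly_normal (char_poly A)).

Lemma mem_spectrum (n : nat) (A : 'M[algC]_n) z :
  (z \in spectrum A) = eigenvalue A z.
Proof.
rewrite /spectrum eigenvalue_root_char; case: closed_field_poly_normal => s /= ->.
by rewrite (monicP (char_poly_monic A)) scale1r root_prod_XsubC.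
Qed.

Definition spectral_radius (n : nat) (M : 'M[int]_n) : algC :=
  \big[Num.max/0]_(z <- spectrum (map_mx (intr : int -> algC) M)) `|z|.

Lemma bigmax_normP (s : seq algC) :
  let m := \big[Num.max/0]_(z <- s) `|z| in
  [/\ 0 <= m, forall z, z \in s -> `|z| <= m
    & s != [::] -> exists2 z, z \in s & `|z| = m].
Proof.
elim: s => [|a s [m0 ub att]] /=; first by rewrite big_nil lexx.
rewrite big_cons; set m := bigop _ _ _ in m0 ub att *.
have [le_am|lt_ma] := real_leP (normr_real a) (ger0_real m0).
  split=> // [z|_]; first by rewrite inE => /predU1P[->|/ub].
  have [s0|/att[z zs <-]] := eqVneq s [::]; last by exists z; rewrite // inE zs orbT.
  exists a; rewrite ?mem_head //; apply/le_anti; rewrite le_am /=.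
  by rewrite /m s0 big_nil normr_ge0.
split=> [|z|_]; rewrite ?normr_ge0 //; last by exists a; rewrite ?mem_head.
by rewrite inE => /predU1P[->//|/ub/le_trans]; apply; apply: ltW.
Qed.

Lemma spectral_radius_ge (n : nat) (M : 'M[int]_n) z :
  eigenvalue (map_mx intr M) z -> `|z| <= spectral_radius M.
Proof. by rewrite -mem_spectrum => /(let: And3 _ ub _ := bigmax_normP _ in ub _). Qed.

Lemma spectral_radius_attained (n : nat) (M : 'M[int]_n) : (0 < n)%N ->
  exists2 z, eigenvalue (map_mx intr M) z & `|z| = spectral_radius M.
Proof.
set A := map_mx (intr : int -> algC) M => n0.
have [|z] := let: And3 _ _ att := bigmax_normP (spectrum A) in att.
  apply/negP => /eqP sp0; have := size_char_poly A.
  move: sp0; rewrite /spectrum; case: closed_field_poly_normal => s /= -> ->.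
  by rewrite big_nil (monicP (char_poly_monic A)) scale1r size_poly1 => -[n_eq]; rewrite -n_eq in n0.
by rewrite mem_spectrum => Az Ez; exists z.
Qed.

(* Main.v *)
(* If |mu| >= 2 for an eigenvalue mu of N = M^m, then a word of length l in
   x t^m and y t^m is a monomial whose exponent is a sum of the e_i N^j, with
   i in {1, 2} and j < l.  Pairing this exponent with a column eigenvector of N
   sends distinct words to distinct values, because the values
   \sum_j b_j mu^j with b_j in {0, 1} are distinct: the top term of a
   difference dominates all others.  So distinct words are distinct monomials.

   If the spectral radius is at most 1, Cayley-Hamilton in the form
   (M - z2) (M - z1) = 0 shows that the entries of M^n grow at most linearly.
   The 2^l words of length l in two given elements are then supported on a set
   of monomials of size polynomial in l, so they are linearly dependent for
   large l. *)
Require Import Defs.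
From HB Require Import structures.
From mathcomp Require Import all_boot all_order all_algebra all_field.
From mathcomp Require Import finmap boolp classical_sets monalg.
From mathcomp Require Import zify ring.

Set Implicit Arguments.
Unset Strict Implicit.
Unset Printing Implicit Defensive.

Import Order.TTheory GRing.Theory Num.Theory.

Local Open Scope ring_scope.

(** * Evaluation of the free algebra at a family of elements *)

Section WordEvaluation.
Context (k : comNzRingType) (S : algType k) (I : choiceType) (g : I -> S).

Definition word_val (w : {fmonom I}) : S := \prod_(i <- (w : seq I)) g i.

Lemma word_val_mmorphism : mmorphism word_val.
Proof.
split; last by rewrite /word_val fm1 big_nil.
by move=> w1 w2; rewrite /word_val fmM big_cat.
Qed.

HB.instance Definition _ :=
  monalg.isMultiplicative.Build {fmonom I} S word_val word_val_mmorphism.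

Definition word_eval : {malg k[{fmonom I}]} -> S := mmap (in_alg S) word_val.

Lemma word_eval_is_additive : additive word_eval.
Proof. exact: mmap_is_additive. Qed.

HB.instance Definition _ :=
  GRing.isAdditive.Build {malg k[{fmonom I}]} S word_eval
    word_eval_is_additive.

Lemma word_eval_is_multiplicative : multiplicative word_eval.
Proof.
apply: commr_mmap_is_multiplicative => w w' c.
by rewrite /GRing.comm /= -scalerAl -scalerAr mul1r mulr1.
Qed.

HB.instance Definition _ :=
  GRing.isMultiplicative.Build {malg k[{fmonom I}]} S word_eval
    word_eval_is_multiplicative.

Lemma word_eval_is_scalable : scalable word_eval.
Proof. by move=> c f; rewrite /word_eval mmapZ -scalerAl mul1r. Qed.

HB.instance Definition _ :=
  GRing.isScalable.Build k {malg k[{fmonom I}]} S *:%R word_eval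
    word_eval_is_scalable.

Lemma word_evalE f : word_eval f = \sum_(w <- msupp f) f@_w *: word_val w.
Proof.
by apply: eq_bigr => w _; rewrite -scalerAl mul1r.
Qed.

Lemma word_eval_gen i : word_eval << fmu i >> = g i.
Proof.
by rewrite /word_eval mmapU /= scale1r mul1r /word_val fmuE big_seq1.
Qed.

Lemma range_word_eval : range word_eval = gen_subalg (range g).
Proof.
rewrite eqEsubset; split.
  move=> _ [f _ <-] B [[B1 Blin BM] gB].
  (* Zero is needed for the empty sum; it arises as -1 times 1, plus 1. *)
  have B0 : B 0 by have := Blin (-1) 1 1 B1 B1; rewrite scaleN1r addNr.
  rewrite word_evalE; elim: (X in \sum_(w <- X) _) => [|w s IHs].
    by rewrite big_nil.
  rewrite big_cons; apply: Blin => //; rewrite /word_val.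
  elim: (w : seq I) => [|i t IHt]; first by rewrite big_nil.
  by rewrite big_cons; apply: BM => //; apply: gB; exists i.
apply: smallest_sub => [|_ [i _ <-]]; last first.
  by exists << fmu i >>; rewrite ?word_eval_gen.
split.
- by exists 1; rewrite ?rmorph1.
- by move=> c _ _ [f1 _ <-] [f2 _ <-]; exists (c *: f1 + f2); rewrite ?linearP.
- by move=> _ _ [f1 _ <-] [f2 _ <-]; exists (f1 * f2); rewrite ?rmorphM.
Qed.

Lemma freely_generates_gen :
  injective word_eval -> freely_generates g (gen_subalg (range g)).
Proof.
move=> inj; exists word_eval; split=> //; first exact: word_eval_gen.
exact: range_word_eval.
Qed.

End WordEvaluation.

Lemma subalgebra_gen (k : comNzRingType) (S : algType k) (X : set S) :
  subalgebra (gen_subalg X).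
Proof.
split=> [B [[]] // | c u v Xu Xv B hB | u v Xu Xv B hB].
- have [[_ Blin _] _] := hB; apply: Blin; [exact: Xu|exact: Xv].
- have [[_ _ BM] _] := hB; apply: BM; [exact: Xu|exact: Xv].
Qed.

Lemma free_on_pair_contains (k : comNzRingType) (S : algType k) (u v : S) :
  free_on_pair u v -> contains_free_subalgebra S.
Proof.
move=> uv; exists (gen_subalg [set u; v]%classic); split.
  exact: subalgebra_gen.
by exists bool, (fun b => if b then v else u); split=> //; exists true, false.
Qed.

Lemma range_pair (T : Type) (u v : T) :
  range (fun b : bool => if b then v else u) = [set u; v]%classic.
Proof.
rewrite eqEsubset; split=> [_ [[] _ <-]|_ [->|->]]; [by right|by left| |].
  by exists false.
by exists true.
Qed.

Lemma pair_mulrz (U V : zmodType) (u : U) (v : V) (n : int) :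
  (u, v) *~ n = (u *~ n, v *~ n).
Proof.
have H m : (u, v) *+ m = (u *+ m, v *+ m).
  by elim: m => [|m IHm]; rewrite ?mulr0n // !mulrS IHm.
by case: n => n; rewrite ?NegzE ?mulrNz -!pmulrn H.
Qed.

(** * Monomials of the skew Laurent ring and their coefficients *)

Section LaurentMonomials.
Context (k : comNzRingType) (M : 'M[int]_2).
Context (sigma : {lrmorphism laurent k -> laurent k}).
Hypothesis hx : sigma (lau_x k) = lau_x k ^ (M 0 0) * lau_y k ^ (M 0 1).
Hypothesis hy : sigma (lau_y k) = lau_x k ^ (M 1 0) * lau_y k ^ (M 1 1).

(** A ring morphism commutes with integer powers of units, so the values at x and y determine
    [sigma] on all monomials. *)
Lemma sigma_gmon u : sigma (gmon k u) = gmon k (mon_act M u).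
Proof.
case: u => i j.
have sX : sigma (lau_x k ^ i) = sigma (lau_x k) ^ i.
  exact: (rmorphXz sigma i (lau_x_unit k)).
have sY : sigma (lau_y k ^ j) = sigma (lau_y k) ^ j.
  exact: (rmorphXz sigma j (lau_y_unit k)).
rewrite hx in sX; rewrite hy in sY.
have -> : mon_act M (i, j) =
    (M 0 0, M 0 1) *~ i + (M 1 0, M 1 1) *~ j.
  by rewrite 2!pair_mulrz 4!mulrzz /mon_act /= 2!(mulrC i) 2!(mulrC j).
have -> : gmon k (i, j) = lau_x k ^ i * lau_y k ^ j :> laurent k.
  exact: lau_monE.
have monX a b n : (lau_x k ^ a * lau_y k ^ b) ^ n = gmon k ((a, b) *~ n).
  apply: etrans (congr1 (fun p : laurent k => p ^ n) _) (esym (gmonMz k _ n)).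
  exact: esym (lau_monE k a b).
apply: etrans (rmorphM sigma _ _) _; apply: etrans (congr2 *%R sX sY) _.
by apply: etrans (congr2 *%R (monX _ _ _) (monX _ _ _)) (esym (gmonD _ _ _)).
Qed.

Lemma iter_sigma_gmon n u :
  iter n sigma (gmon k u) = gmon k (mon_act (M ^+ n) u).
Proof.
elim: n => [|n IHn] /=; first by rewrite expr0 mon_act1.
by rewrite IHn sigma_gmon mon_act_comp exprSr mulmxE.
Qed.

(** These elements form a k-basis, and a product of two of them is again one of them. *)
Definition smono (u : int * int) (n : nat) : skew_poly sigma :=
  smon sigma (gmon k u) n.

Lemma smono00 : smono 0 0 = 1.
Proof.
transitivity (smon sigma 1 0); last by [].
exact: (congr1 (fun c : laurent k => smon sigma c 0) (gmon0 k _)).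
Qed.

Lemma smonoM u v m n :
  smono u m * smono v n = smono (u + mon_act (M ^+ m) v) (m + n).
Proof. by rewrite /smono smonM iter_sigma_gmon gmonD. Qed.

(** The linear forms dual to the basis [smono]; they serve both to separate words and to describe
    supports. *)
Definition scoef (n : nat) (u : int * int) (p : skew_poly sigma) : k :=
  ((p : {poly laurent k})`_n : {malg k[(int * int)%type]})@_u.

Lemma scoef_is_additive n u : additive (scoef n u).
Proof. by move=> p q; rewrite /scoef coefB mcoeffB. Qed.

HB.instance Definition _ n u :=
  GRing.isAdditive.Build (skew_poly sigma) k (scoef n u)
    (scoef_is_additive n u).

Lemma scoef_is_scalable n u : scalable_for *%R (scoef n u).
Proof.
move=> c p; rewrite /scoef -[c *: p]/(c%:A *: (p : {poly laurent k})).
by rewrite coefZ -scalerAl mul1r mcoeffZ.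
Qed.

HB.instance Definition _ n u :=
  GRing.isScalable.Build k (skew_poly sigma) k *%R (scoef n u)
    (scoef_is_scalable n u).

Lemma scoef_smono n u m v : scoef n u (smono v m) = ((n == m) && (u == v))%:R.
Proof.
rewrite /scoef /smono /smon coefZ coefXn.
case: eqP => _; last by rewrite mulr0 mcoeff0.
by rewrite mulr1 mcoeffU eq_sym; case: eqP.
Qed.

Lemma scoef_inj p q : (forall n u, scoef n u p = scoef n u q) -> p = q.
Proof. by move=> pq; apply/polyP => n; apply/malgP => u; apply: pq. Qed.

Lemma smono_expand p :
  p = \sum_(n < size (p : {poly laurent k}))
        \sum_(u <- msupp
            ((p : {poly laurent k})`_n : {malg k[(int * int)%type]}))
          scoef n u p *: smono u n.
Proof.
apply: etrans (skew_polyE p) _; apply: eq_bigr => n _.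
rewrite [in LHS](grpalgE (_`_n)) /smon scaler_suml; apply: eq_bigr => u _.
by rewrite sscaleU.
Qed.

End LaurentMonomials.

(** * Sums with digits 0 and 1 in a base of modulus at least 2 *)

Section DyadicSums.
Variable mu : algC.

(* The digits are listed lowest first. *)
Fixpoint digit_sum (s : seq bool) : algC :=
  if s is b :: s' then b%:R + mu * digit_sum s' else 0.

Lemma digit_sum_rcons s b :
  digit_sum (rcons s b) = digit_sum s + b%:R * mu ^+ size s.
Proof.
elim: s => [|c s IHs] /=; first by rewrite mulr0 addr0 add0r mulr1.
by rewrite IHs exprS mulrDr addrA mulrCA.
Qed.

Hypothesis mu_ge2 : 2 <= `|mu|.

(** The digits of the difference lie in {-1, 0, 1}, so its modulus is at most 1 + r + ... + r^(l-1)
    with r = |mu|, and this is at most r^l - 1 because r is at least 2. *)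
Lemma digit_sum_dist s s' : size s = size s' ->
  `|digit_sum s - digit_sum s'| <= `|mu| ^+ size s - 1.
Proof.
elim/last_ind: s s' => [|s b IHs] s'.
  by move/esym/size0nil=> ->; rewrite subrr normr0 expr0 subrr.
case/lastP: s' => [|s' b']; rewrite !size_rcons // => -[ss'].
rewrite !digit_sum_rcons -ss' opprD addrACA -mulrBl.
apply: le_trans (ler_normD _ _) _.
have le_dist : `|(b%:R - b'%:R) * mu ^+ size s| <= `|mu| ^+ size s.
  rewrite normrM normrX ler_piMl ?exprn_ge0 //.
  by case: b b' => -[]; rewrite ?subrr ?subr0 ?sub0r ?normrN ?normr0 ?normr1.
apply: le_trans (lerD (IHs _ ss') le_dist) _.
rewrite addrAC lerD2r exprS -mulr2n -mulr_natl.
by rewrite ler_wpM2r ?exprn_ge0.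
Qed.

Lemma digit_sum_inj s s' :
  size s = size s' -> digit_sum s = digit_sum s' -> s = s'.
Proof.
elim/last_ind: s s' => [|s b IHs] s'; first by move/esym/size0nil.
case/lastP: s' => [|s' b']; rewrite !size_rcons // => -[ss'].
rewrite !digit_sum_rcons -ss' => eq_ds.
have [eq_b|ne_b] := eqVneq b b'.
  by rewrite eq_b in eq_ds *; rewrite (IHs s') //; apply: addIr eq_ds.
(* Differing top digits make the modulus of the top term equal to the distance between the lower
   parts. *)
have: `|mu| ^+ size s <= `|mu| ^+ size s - 1.
  apply: le_trans (digit_sum_dist ss').
  have -> : digit_sum s - digit_sum s' = (b'%:R - b%:R) * mu ^+ size s.
    rewrite mulrBl; apply/eqP; rewrite subr_eq addrAC eq_sym subr_eq eq_sym.
    by rewrite eq_ds addrC.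
  rewrite normrM normrX.
  by case: b b' ne_b {eq_ds} => -[] //;
    rewrite ?subr0 ?sub0r ?normrN normr1 mul1r.
by rewrite lerDl oppr_ge0 ler10.
Qed.

End DyadicSums.

(** * Column eigenvectors and exponents of words *)

Lemma intr_norm_eq1 (a b : int) :
  `|a%:~R * b%:~R : algC| = 1 -> `|a%:~R : algC| = 1.
Proof.
rewrite -intrM -!intr_norm normrM => /(@intr_inj algC _ 1).
rewrite -!abszE -PoszM => -[/eqP]; rewrite muln_eq1 => /andP[/eqP-> _].
by [].
Qed.

(** [eigenvalue] is defined through row vectors; the transpose supplies the column eigenvector to be
    paired with exponents, on which matrices act as on rows. *)
Lemma eigenvalue_tr (F : fieldType) n (A : 'M[F]_n) a :
  eigenvalue A^T a = eigenvalue A a.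
Proof.
rewrite !eigenvalue_root_char /char_poly -[in RHS]det_tr.
congr (root (\det _) a).
by rewrite /char_poly_mx linearB /= tr_scalar_mx map_trmx.
Qed.

Lemma det2 (R : comNzRingType) (A : 'M[R]_2) :
  \det A = A 0 0 * A 1 1 - A 0 1 * A 1 0.
Proof.
rewrite (expand_det_row _ ord0) !big_ord_recl big_ord0 addr0.
rewrite /cofactor !det_mx11 !mxE /= expr0 mul1r expr1 mulN1r mulrN.
by congr (_ * A _ _ - A _ _ * A _ _); apply: val_inj.
Qed.

(* If the two coordinates agreed, [mu] would be an integer, hence a unit. *)
Lemma eigencolumn (N : 'M[int]_2) (mu : algC) :
  N \in unitmx -> 2 <= `|mu| -> eigenvalue (map_mx intr N) mu ->
  exists w0 w1 : algC, [/\ w0 != w1,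
    (N 0 0)%:~R * w0 + (N 0 1)%:~R * w1 = mu * w0
  & (N 1 0)%:~R * w0 + (N 1 1)%:~R * w1 = mu * w1].
Proof.
move=> Nu mu2; rewrite -eigenvalue_tr => /eigenvalueP[v /rowP vN v0].
have E1 : lift ord0 ord0 = 1 :> 'I_2 by exact: val_inj.
have := vN 0; have := vN 1; rewrite !mxE !big_ord_recl !big_ord0 !addr0 !mxE E1.
rewrite ![v ord0 _ * _]mulrC => e1 e0; exists (v 0 0), (v 0 1); split=> //.
apply: contraNneq v0 => v01; rewrite -v01 -mulrDl in e0 e1.
have [v00|v00] := eqVneq (v 0 0) 0.
  apply/eqP/rowP => i; rewrite mxE.
  have [->//|->] : i = 0 \/ i = 1.
    by case: i => -[|[|//]] lt_i2; [left|right]; apply: val_inj.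
  by rewrite -v01.
move/(mulIf v00): e0 => e0; rewrite -mulrDl in e1; move/(mulIf v00): e1 => e1.
(* Both row sums of [N] equal [mu], so the trace leaves [N 0 0 - N 1 0] as the other eigenvalue;
   their product is the determinant, which is 1 or -1. *)
have: `|(N 0 0 + N 0 1)%:~R * (N 0 0 - N 1 0)%:~R : algC| = 1.
  rewrite -intrM -intr_norm.
  have -> : (N 0 0 + N 0 1) * (N 0 0 - N 1 0) = \det N.
    have N11 : N 1 1 = N 0 0 + N 0 1 - N 1 0.
      by apply: (@intr_inj algC); rewrite intrB intrD e0 -e1 addrC addKr.
    by rewrite det2 N11; ring.
  by move: Nu; rewrite unitmxE => /orP[] /eqP->; rewrite ?normrN normr1.
move/intr_norm_eq1; rewrite intrD e0 => mu1; move: mu2.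
by rewrite mu1 -[1]/(1%:R) ler_nat.
Qed.

Definition unit_exp (b : bool) : int * int := if b then (0, 1) else (1, 0).

(** Horner form of the sum of the row vectors [unit_exp] b_j times N^j: the twisted product applies
    N to the exponent of everything to the right of a letter. *)
Fixpoint word_exp (N : 'M[int]_2) (s : seq bool) : int * int :=
  if s is b :: s' then unit_exp b + mon_act N (word_exp N s') else 0.

Lemma word_exp_inj (N : 'M[int]_2) (mu : algC) s s' :
  N \in unitmx -> 2 <= `|mu| -> eigenvalue (map_mx intr N) mu ->
  size s = size s' -> word_exp N s = word_exp N s' -> s = s'.
Proof.
move=> Nu mu2 /(eigencolumn Nu mu2)[w0 [w1 [w01 e0 e1]]].
pose chi (u : int * int) : algC := u.1%:~R * w0 + u.2%:~R * w1.
have chiD u v : chi (u + v) = chi u + chi v.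
  by rewrite /chi !intrD !mulrDl addrACA.
have chiN u : chi (mon_act N u) = mu * chi u.
  rewrite /chi /mon_act /= !intrD !intrM [RHS]mulrDr !(mulrCA mu) -e0 -e1.
  by ring.
(* A letter b contributes w0 + b (w1 - w0); for words of equal length the w0 parts cancel in the
   difference and only digit sums remain. *)
have chi_dist t t' : size t = size t' ->
    chi (word_exp N t) - chi (word_exp N t') =
    (w1 - w0) * (digit_sum mu t - digit_sum mu t').
  elim: t t' => [|b t IHt] [|b' t'] //= => [_|[/IHt tt']].
    by rewrite !subrr mulr0.
  rewrite !chiD !chiN opprD addrACA -mulrBr tt'.
  by case: b b' => -[]; rewrite /chi /=; ring.
move=> ss' /(congr1 chi) => /eqP; rewrite -subr_eq0 chi_dist //.
rewrite mulf_eq0 !subr_eq0 eq_sym (negPf w01) => /eqP.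
exact: digit_sum_inj.
Qed.

(** * Freeness when a power of the matrix has an eigenvalue of modulus at least 2 *)

Section FreePair.
Context (k : comNzRingType) (M : 'M[int]_2).
Context (sigma : {lrmorphism laurent k -> laurent k}).
Hypothesis hx : sigma (lau_x k) = lau_x k ^ (M 0 0) * lau_y k ^ (M 0 1).
Hypothesis hy : sigma (lau_y k) = lau_x k ^ (M 1 0) * lau_y k ^ (M 1 1).

Lemma word_val_smono m (w : {fmonom bool}) :
  word_val (fun b => smono sigma (unit_exp b) m) w =
  smono sigma (word_exp (M ^+ m) w) (m * size w).
Proof.
rewrite /word_val; elim: (w : seq bool) => [|b s IHs] /=.
  by rewrite big_nil muln0 (smono00 sigma).
by rewrite big_cons IHs (smonoM hx hy) mulnS.
Qed.

Lemma smono_pair_free (m : nat) (mu : algC) : M \in unitmx -> (0 < m)%N ->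
  2 <= `|mu| -> eigenvalue (map_mx intr (M ^+ m)) mu ->
  free_on_pair (smono sigma (1, 0) m) (smono sigma (0, 1) m).
Proof.
move=> Mu m0 mu2 eig; rewrite /free_on_pair -range_pair.
have -> : (fun b : bool => if b then smono sigma (0, 1) m
    else smono sigma (1, 0) m) = (fun b => smono sigma (unit_exp b) m).
  by apply: funext; case.
apply: freely_generates_gen; set g := fun b => _.
have Nu : M ^+ m \in unitmx by apply: (unitrX m Mu).
(* Since [m] is positive, the degree in t recovers the length of a word, so only words of equal
   length have to be compared. *)
have smono_inj (w w' : {fmonom bool}) :
    (m * size w == m * size w')%N &&
    (word_exp (M ^+ m) w == word_exp (M ^+ m) w') = (w == w').
  apply/idP/eqP => [|->]; last by rewrite !eqxx.
  case/andP => /eqP/eqP; rewrite eqn_pmul2l // => /eqP sz /eqP we.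
  by apply/eqP; rewrite fmP (word_exp_inj Nu mu2 eig sz we).
move=> f f' ff'; apply/eqP; rewrite -subr_eq0; apply/eqP/malgP => w0.
have: word_eval g (f - f') = 0 by rewrite raddfB /= ff' subrr.
move: (f - f') => {ff'} {}f.
(* Distinct words being distinct basis elements, this coefficient of the image is the coefficient of
   [w0] in [f]. *)
move/(congr1 (scoef (m * size w0) (word_exp (M ^+ m) w0))).
rewrite raddf0 word_evalE raddf_sum /= mcoeff0 => <-.
rewrite [in LHS](monalgE f) raddf_sum /=; apply: eq_bigr => w _.
rewrite linearZ /= mcoeffU word_val_smono scoef_smono smono_inj.
by rewrite eq_sym mulr_natr.
Qed.

End FreePair.

(** * Growth of matrix powers for spectral radius at most 1 *)

(** (A - z2)(A - z1) = 0 gives A^n (A - z1) = z2^n (A - z1), hence A^(n+1) = z1 A^n + z2^n (A - z1):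
    each step adds to an entry at most the modulus of an entry of A - z1. *)
Lemma entry_power_bound (M : 'M[int]_2) : spectral_radius M <= 1 ->
  exists c : nat, forall n i j, (absz ((M ^+ n) i j) <= c * n.+1)%N.
Proof.
move=> rM; set A := map_mx (intr : int -> algC) M.
have [z1 [z2 [z1_le z2_le A0]]] : exists z1 z2 : algC,
    [/\ `|z1| <= 1, `|z2| <= 1 & (A - z2%:M) * (A - z1%:M) = 0].
  have := size_char_poly A; have := Cayley_Hamilton A.
  have le1 z : z \in spectrum A -> `|z| <= 1.
    by rewrite mem_spectrum => /spectral_radius_ge/le_trans; apply.
  move: le1; rewrite /spectrum; case: closed_field_poly_normal => s /= ->.
  rewrite (monicP (char_poly_monic A)) scale1r size_prod_XsubC.
  case: s => [|z2 [|z1 [|z3 s]]] // le1 + _.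
  rewrite !big_cons big_nil mulr1 rmorphM !rmorphB /= !horner_mx_X !horner_mx_C.
  by exists z1, z2; rewrite !le1 ?inE ?eqxx ?orbT.
have AX n : map_mx intr (M ^+ n) = A ^+ n by rewrite rmorphXn.
have recA n : A ^+ n.+1 = z1 *: A ^+ n + z2 ^+ n *: (A - z1%:M).
  have E : A ^+ n * (A - z1%:M) = z2 ^+ n *: (A - z1%:M).
    elim: n => [|n IHn]; first by rewrite !expr0 mul1r scale1r.
    rewrite exprSr -mulrA; move/eqP: A0; rewrite mulrBl subr_eq0 => /eqP->.
    rewrite [_%:M * _]mul_scalar_mx -scalerAr IHn scalerA.
    by rewrite exprS.
  rewrite -E mulrBr -exprSr addrC.
  by rewrite [A ^+ n * _%:M]mul_mx_scalar subrK.
pose b i j := Num.bound (`|(A - z1%:M) i j|).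
(* The sum bounds every entry of A - z1; the extra 1 covers the identity matrix at n = 0. *)
pose c := (\sum_i \sum_j b i j + 1)%N.
exists c => n i j.
have b_le : `|(A - z1%:M) i j| <= c%:R.
  apply: le_trans (ltW (archi_boundP (normr_ge0 _))) _.
  rewrite ler_nat -/(b i j) /c (bigD1 i) //= (bigD1 j) //= -!addnA.
  exact: leq_addr.
rewrite -(ler_nat algC) natr_absz intr_norm.
have -> : ((M ^+ n) i j)%:~R = (A ^+ n) i j by rewrite -AX mxE.
elim: n => [|n IHn].
  rewrite expr0 muln1 mxE; case: eqP => _; rewrite ?normr0 ?normr1 // ler1n.
  by rewrite /c addn1.
rewrite recA; move: (A - z1%:M) b_le => B b_le; rewrite 3!mxE.
apply: le_trans (ler_normD _ _) _; rewrite mulnS addnC natrD !normrM normrX.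
apply: lerD; first by apply: le_trans IHn; rewrite ler_piMl.
by apply: le_trans b_le; rewrite ler_piMl // exprn_ile1.
Qed.

(** * Supports of products *)

Section Boxes.
Context (k : comNzRingType) (M : 'M[int]_2).
Context (sigma : {lrmorphism laurent k -> laurent k}).
Hypothesis hx : sigma (lau_x k) = lau_x k ^ (M 0 0) * lau_y k ^ (M 0 1).
Hypothesis hy : sigma (lau_y k) = lau_x k ^ (M 1 0) * lau_y k ^ (M 1 1).
Implicit Types p q : skew_poly sigma.

(** Exponents and t-degree get separate bounds, because the growth of exponents in a product depends
    on the t-degree of the left factor. *)
Definition in_box (b d : nat) p : Prop := forall n u,
  scoef n u p != 0 -> [&& (n <= d)%N, (absz u.1 <= b)%N & (absz u.2 <= b)%N].

Lemma in_box0 b d : in_box b d 0.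
Proof. by move=> n u; rewrite raddf0 eqxx. Qed.

Lemma in_boxD b d p q : in_box b d p -> in_box b d q -> in_box b d (p + q).
Proof.
move=> bp bq n u; rewrite raddfD /=.
have [->|/bp //] := eqVneq (scoef n u p) 0; rewrite add0r; exact: bq.
Qed.

Lemma in_boxZ b d (a : k) p : in_box b d p -> in_box b d (a *: p).
Proof.
move=> bp n u; rewrite linearZ /= => nz; apply: bp.
by apply: contraNneq nz => ->; rewrite mulr0.
Qed.

Lemma in_box_sum b d (T : Type) (s : seq T) (F : T -> skew_poly sigma) :
  (forall t, in_box b d (F t)) -> in_box b d (\sum_(t <- s) F t).
Proof. by move=> bF; apply: big_ind => //; [exact: in_box0|exact: in_boxD]. Qed.

Lemma in_box_smono b d u n :
  (n <= d)%N -> (absz u.1 <= b)%N -> (absz u.2 <= b)%N ->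
  in_box b d (smono sigma u n).
Proof.
move=> nd u1 u2 m v; rewrite scoef_smono.
by case: andP => [[/eqP-> /eqP->] _|_]; rewrite ?eqxx // nd u1 u2.
Qed.

Lemma in_boxW b d b' d' p :
  (b <= b')%N -> (d <= d')%N -> in_box b d p -> in_box b' d' p.
Proof.
move=> bb dd bp n u /bp /and3P[nd u1 u2].
by rewrite !(leq_trans _ dd, leq_trans _ bb).
Qed.

Lemma in_box_ex p : exists b, in_box b b p.
Proof.
suff sum_ex (T : Type) (s : seq T) (F : T -> skew_poly sigma) :
    (forall t, exists b, in_box b b (F t)) ->
    exists b, in_box b b (\sum_(t <- s) F t).
  rewrite (@smono_expand k sigma p); apply: (sum_ex) => n; apply: sum_ex => u.
  exists (n + (absz u.1 + absz u.2))%N; apply: in_boxZ; apply: in_box_smono.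
  - exact: leq_addr.
  - by rewrite addnCA leq_addr.
  - by rewrite addnA leq_addl.
move=> bF; elim: s => [|t s [b IHs]].
  by exists 0%N; rewrite big_nil; exact: in_box0.
have [b' bt] := bF t; exists (b + b')%N; rewrite big_cons; apply: in_boxD.
  by apply: in_boxW bt; exact: leq_addl.
by apply: in_boxW IHs; exact: leq_addr.
Qed.

(** A product of monomials has exponent u + v M^n with n at most d. The entries of M^n are at most c
    (d + 1), and each coordinate of v M^n is a sum of two products, whence the factor 2. *)
Lemma in_boxM (c b d b' d' : nat) p q :
  (forall n i j, (absz ((M ^+ n) i j) <= c * n.+1)%N) ->
  in_box b d p -> in_box b' d' q ->
  in_box (b + 2 * (c * d.+1) * b') (d + d') (p * q).
Proof.
move=> Mc bp bq; rewrite (@smono_expand k sigma p) mulr_suml.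
apply: in_box_sum => n; rewrite mulr_suml; apply: in_box_sum => u.
rewrite -scalerAl; have [->|/bp/and3P[nd u1 u2]] := eqVneq (scoef n u p) 0.
  by rewrite scale0r; exact: in_box0.
apply: in_boxZ; rewrite (@smono_expand k sigma q) mulr_sumr.
apply: in_box_sum => m; rewrite mulr_sumr; apply: in_box_sum => v.
rewrite -scalerAr; have [->|/bq/and3P[md v1 v2]] := eqVneq (scoef m v q) 0.
  by rewrite scale0r; exact: in_box0.
apply: in_boxZ; rewrite (smonoM hx hy).
have le_prod (x : int) i j : (absz x <= b')%N ->
    (absz (x * (M ^+ n) i j)%R <= c * d.+1 * b')%N.
  move=> xb; rewrite abszM mulnC; apply: leq_mul xb.
  by apply: leq_trans (Mc n i j) _; rewrite leq_mul2l ltnS nd orbT.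
apply: in_box_smono; first exact: leq_add.
  rewrite /mon_act /=.
  have := le_prod _ 0 0 v1; have := le_prod _ 1 0 v2; move: u1 => /=.
  move: (v.1 * _) (v.2 * _) => x y; lia.
rewrite /mon_act /=.
have := le_prod _ 0 1 v1; have := le_prod _ 1 1 v2; move: u2 => /=.
move: (v.1 * _) (v.2 * _) => x y; lia.
Qed.

(* Multiplying by one generator at a time on the right, each step costs only
   a factor linear in the [t]-degree reached so far. *)
Lemma in_box_prod (c b l : nat) (I : Type) (g : I -> skew_poly sigma)
    (s : seq I) :
  (forall n i j, (absz ((M ^+ n) i j) <= c * n.+1)%N) ->
  (forall i, in_box b b (g i)) -> (size s <= l)%N ->
  in_box (size s * (2 * (c * (l * b).+1) * b)) (size s * b)
    (\prod_(i <- s) g i).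
Proof.
move=> Mc bg; elim/last_ind: s => [_|s i IHs].
  rewrite big_nil -(smono00 sigma); exact: in_box_smono.
rewrite size_rcons => sl; rewrite -cats1 big_cat big_seq1 /=.
apply: in_boxW (in_boxM Mc (IHs (ltnW sl)) (bg i)).
  rewrite [in leqRHS]mulSn addnC leq_add2r leq_mul2r; apply/orP; right.
  by rewrite leq_mul2l leq_mul2l ltnS leq_mul2r (ltnW sl) !orbT.
by rewrite mulSn addnC.
Qed.

End Boxes.

(** * Counting words against monomials *)

(** A matrix with more rows than columns has a nonzero left kernel. In the application, rows are
    words and columns are the monomials of a box. *)
Lemma linear_dependency (k : fieldType) (T C : finType) (f : T -> C -> k) :
  (#|C| < #|T|)%N ->
  exists a : T -> k,
    (exists t, a t != 0) /\ forall x, \sum_t a t * f t x = 0.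
Proof.
move=> CT; pose A := \matrix_(i < #|T|, j < #|C|) f (enum_val i) (enum_val j).
have: kermx A != 0.
  rewrite -mxrank_eq0 mxrank_ker subn_eq0 -ltnNge.
  exact: leq_ltn_trans (rank_leq_col A) CT.
case/rowV0Pn=> v /sub_kermxP vA v0; exists (fun t => v 0 (enum_rank t)); split.
  have [i vi] : exists i, v 0 i != 0.
    apply/existsP; apply: contraNT v0; rewrite negb_exists => /forallP v0.
    by apply/eqP/rowP => i; rewrite mxE; apply/eqP; rewrite -[_ == _]negbK v0.
  by exists (enum_val i); rewrite enum_valK.
move=> x; have vAx : (v *m A) 0 (enum_rank x) = 0 by rewrite vA mxE.
rewrite mxE in vAx; rewrite -[RHS]vAx [RHS](reindex enum_rank) /=; last first.
  exact: onW_bij (enum_rank_bij _).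
by apply: eq_bigr => t _; rewrite mxE !enum_rankK.
Qed.

Lemma poly_lt_exp (q : nat) : exists l, (q * l.+1 ^ 5 < 2 ^ l)%N.
Proof.
(* With l + 1 = 2^s and q < 2^q, it suffices that q + 5 s < 2^s; for s = q + 6 this follows from s^2
   <= 2^s. *)
pose s := (q + 6)%N; exists (2 ^ s).-1.
have s_sq m : (4 <= m -> m * m <= 2 ^ m)%N.
  elim: m => // m IHm; rewrite leq_eqVlt => /predU1P[<-//|lt4m].
  by have := IHm lt4m; rewrite expnS; nia.
have s4 : (4 <= s)%N by rewrite /s; lia.
rewrite prednK ?expn_gt0 // -expnM.
apply: (@leq_trans (2 ^ (q + s * 5))).
  by rewrite expnD ltn_pmul2r ?expn_gt0 // ltn_expl.
rewrite leq_exp2l //; have := s_sq s s4; rewrite /s; nia.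
Qed.

(** The left side counts the monomials in the box of a product of l factors: l b + 1 degrees and 2 m
    + 1 values of each exponent. As m is at most quadratic in l, the count is at most of order
    l^5. *)
Lemma box_lt_exp (c b : nat) : exists l,
  let m := (l * (2 * (c * (l * b).+1) * b))%N in
  ((l * b).+1 * (m + m).+1 * (m + m).+1 < 2 ^ l)%N.
Proof.
have [l ltl] := poly_lt_exp (b.+1 * (4 * c * b.+1 * b + 1) ^ 2)%N.
exists l; cbv zeta; apply: leq_ltn_trans ltl.
have -> : (b.+1 * (4 * c * b.+1 * b + 1) ^ 2 * l.+1 ^ 5 =
  (b.+1 * l.+1) * ((4 * c * b.+1 * b + 1) * l.+1 ^ 2) *
  ((4 * c * b.+1 * b + 1) * l.+1 ^ 2))%N by ring.
have le1 : ((l * b).+1 <= b.+1 * l.+1)%N by nia.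
set m := (l * (2 * _ * b))%N.
have le2 : ((m + m).+1 <= (4 * c * b.+1 * b + 1) * l.+1 ^ 2)%N.
  have le_m : (m <= 2 * c * b * (b.+1 * l.+1) * l)%N.
    rewrite /m; have -> : (l * (2 * (c * (l * b).+1) * b) =
      2 * c * b * l * (l * b).+1)%N by ring.
    have -> : (2 * c * b * (b.+1 * l.+1) * l =
      2 * c * b * l * (b.+1 * l.+1))%N by ring.
    by rewrite leq_mul2l le1 orbT.
  have le_l : (l <= l.+1)%N by [].
  have : (2 * c * b * (b.+1 * l.+1) * l <= 2 * c * b * (b.+1 * l.+1) * l.+1)%N.
    by rewrite leq_mul2l le_l orbT.
  have : (0 < l.+1 ^ 2)%N by rewrite expn_gt0.
  rewrite mulnDl mul1n => gt0 le_m'.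
  have -> : (4 * c * b.+1 * b * l.+1 ^ 2 =
     2 * c * b * (b.+1 * l.+1) * l.+1 +
     2 * c * b * (b.+1 * l.+1) * l.+1)%N by ring.
  lia.
exact: leq_mul (leq_mul le1 le2) le2.
Qed.

Lemma no_free_subalgebra (k : fieldType) (M : 'M[int]_2)
    (sigma : {lrmorphism laurent k -> laurent k}) :
  sigma (lau_x k) = lau_x k ^ (M 0 0) * lau_y k ^ (M 0 1) ->
  sigma (lau_y k) = lau_x k ^ (M 1 0) * lau_y k ^ (M 1 1) ->
  spectral_radius M <= 1 -> ~ contains_free_subalgebra (skew_poly sigma).
Proof.
move=> hx hy /entry_power_bound[c Mc].
case=> B [_ [I [g [[i [j ij]] [phi [phig phi_inj _]]]]]].
(* Two of the free generators suffice: their words of length l are already too many. *)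
pose pick e := if e then j else i.
pose W (s : seq bool) : {fmonom I} := FMonom (map pick s).
have pick_inj : injective pick.
  by case; case=> //= eij; rewrite eij eqxx in ij.
have W_inj : injective W.
  move=> s s' /(congr1 (fun w : {fmonom I} => w : seq I)).
  exact: inj_map.
have phiW s : phi << W s >> = \prod_(e <- s) g (pick e).
  elim: s => [|e s IHs].
    rewrite big_nil -(rmorph1 phi); congr (phi _).
    by congr (<< _ >>); apply/eqP; rewrite fmP fm1.
  rewrite big_cons -IHs -phig -rmorphM; congr (phi _).
  rewrite malgM_def fgmulUU mulr1; congr (<< _ >>).
  by apply/eqP; rewrite fmP fmM fmU.
have [b bg] : exists b, forall e, in_box b b (g (pick e)).
  have [b1 h1] := in_box_ex (g i); have [b2 h2] := in_box_ex (g j).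
  exists (b1 + b2)%N; case; [apply: in_boxW h2|apply: in_boxW h1];
    by rewrite ?leq_addr ?leq_addl.
have [l] := box_lt_exp c b; set m := (l * (2 * _ * b))%N => lt_card.
(* Subtracting m turns the indices 0, ..., 2 m into the exponents -m, ..., m. *)
pose f (t : l.-tuple bool)
    (x : 'I_(l * b).+1 * 'I_(m + m).+1 * 'I_(m + m).+1) :=
  scoef x.1.1 (x.1.2%:Z - m%:Z, x.2%:Z - m%:Z) (phi << W t >>).
have [|a [[t0 at0] a_dep]] := @linear_dependency k _ _ f.
  by rewrite card_tuple card_bool !card_prod !card_ord.
pose P : {malg k[{fmonom I}]} := \sum_(t : l.-tuple bool) a t *: << W t >>.
(* In the image of [P], coefficients inside the box vanish by the choice of [a], and those outside
   because every word is supported in the box. *)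
have P0 : P = 0.
  apply: phi_inj; rewrite raddf0 raddf_sum /=; apply: scoef_inj => n u.
  rewrite raddf0 raddf_sum /=.
  have W_box (t : l.-tuple bool) : in_box m (l * b) (phi << W t >>).
    have := in_box_prod hx hy Mc bg (leqnn (size (val t))).
    by rewrite phiW size_tuple.
  have [/and3P[nd u1 u2]|out] :=
    boolP [&& (n <= l * b)%N, (absz u.1 <= m)%N & (absz u.2 <= m)%N].
    have lt1 : (absz (u.1 + m%:Z)%R < (m + m).+1)%N by lia.
    have lt2 : (absz (u.2 + m%:Z)%R < (m + m).+1)%N by lia.
    have uE : (Posz (absz (u.1 + m%:Z)%R) - m%:Z,
               Posz (absz (u.2 + m%:Z)%R) - m%:Z) = u.
      by rewrite [RHS]surjective_pairing; congr (_, _); lia.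
    have lt0 : (n < (l * b).+1)%N by [].
    rewrite -[RHS](a_dep (Ordinal lt0, Ordinal lt1, Ordinal lt2)).
    by apply: eq_bigr => t _; rewrite !linearZ /= /f /= uE.
  rewrite big1 // => t _; rewrite !linearZ /=.
  have [->|/W_box] := eqVneq (scoef n u (phi << W t >>)) 0.
    by rewrite mulr0.
  by rewrite (negPf out).
have coefW t : mcoeff (W t0) (a t *: << W t >>) = a t *+ (t == t0).
  by rewrite mcoeffZ mcoeffU mulrnAr mulr1 (inj_eq W_inj) val_eqE.
(* Words are a basis of the free algebra, so the coefficient of [W t0] in [P] is [a t0], which is
   nonzero. *)
have := congr1 (mcoeff (W t0)) P0.
rewrite mcoeff0 /P raddf_sum (eq_bigr _ (fun t _ => coefW t)) (bigD1 t0) //=.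
rewrite eqxx big1 ?addr0 => [a0|t /negPf-> //].
by case/eqP: at0; exact: a0.
Qed.

(** * Powers of eigenvalues and the equivalence *)

Lemma eigenvalueX (F : fieldType) n (A : 'M[F]_n.+1) a m :
  eigenvalue A a -> eigenvalue (A ^+ m) (a ^+ m).
Proof.
case/eigenvalueP=> v vA v0; apply/eigenvalueP; exists v => //.
elim: m => [|m IHm]; first by rewrite !expr0 mulmx1 scale1r.
by rewrite exprSr mulmxA IHm -scalemxAl vA scalerA exprSr.
Qed.

(** Bernoulli's inequality x^m >= 1 + m (x - 1), with m at least 1 / (x - 1). *)
Lemma exprn_ge2 (x : algC) : 1 < x -> exists m, 2 <= x ^+ m.
Proof.
move=> x1; pose y := x - 1; have y0 : 0 < y by rewrite subr_gt0.
have bern m : 1 + m%:R * y <= x ^+ m.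
  elim: m => [|m IHm]; first by rewrite mul0r addr0 expr0.
  have -> : x ^+ m.+1 = x ^+ m + x ^+ m * y.
    by rewrite exprSr mulrBr mulr1 addrC subrK.
  rewrite -natr1 mulrDl mul1r addrA lerD // ler_peMl ?(ltW y0) //.
  by apply: exprn_ege1; apply: ltW.
have := archi_boundP (ltW (divr_gt0 ltr01 y0)); set m := Num.bound _ => lem.
exists m; apply: le_trans (bern m); rewrite -[2]/(1 + 1) lerD2l.
by rewrite -ler_pdivrMr //; apply: ltW.
Qed.

Theorem theorem1p2 (k : fieldType) (M : 'M[int]_2) (hM : M \in unitmx)
    (sigma : {lrmorphism laurent k -> laurent k}) (hsigma : bijective sigma)
    (hx : sigma (lau_x k) = lau_x k ^ (M 0 0) * lau_y k ^ (M 0 1))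
    (hy : sigma (lau_y k) = lau_x k ^ (M 1 0) * lau_y k ^ (M 1 1)) :
  (contains_free_subalgebra (skew_poly sigma) <-> 1 < spectral_radius M) /\
  (1 < spectral_radius M ->
   forall n : nat, 2 <= spectral_radius (M ^+ (2 * n)%N) ->
   free_on_pair (sconst sigma (lau_x k) * svar sigma ^+ (2 * n)%N)
                (sconst sigma (lau_y k) * svar sigma ^+ (2 * n)%N)).
Proof.
have free m : 2 <= spectral_radius (M ^+ m) ->
    free_on_pair (sconst sigma (lau_x k) * svar sigma ^+ m)
                 (sconst sigma (lau_y k) * svar sigma ^+ m).
  have [mu eig <-] := spectral_radius_attained (M ^+ m) isT.
  case: m eig => [|m] eig mu2; last first.
    have := smono_pair_free hx hy hM (ltn0Sn m) mu2 eig.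
    by rewrite /smono 2!smonE.
  (* For m = 0 the matrix is the identity, whose only eigenvalue is 1, against the bound 2. *)
  case/eigenvalueP: eig => v; rewrite expr0 map_mx1 mulmx1 => vE v0.
  move: mu2; have -> : mu = 1.
    apply/eqP; rewrite -subr_eq0; apply: contraNT v0 => mu1.
    by rewrite -(inj_eq (scalerI mu1)) scaler0 scalerBl scale1r -vE subrr.
  by rewrite normr1 -[1]/(1%:R) ler_nat.
split; last by move=> _ n; exact: free.
split=> [contains|r1].
  have [z _ rz] := spectral_radius_attained M isT.
  (* The order on [algC] is partial; the radius is the modulus of an eigenvalue, hence real and
     comparable with 1. *)
  rewrite real_ltNge ?real1 // -?rz ?normr_real //.
  apply/negP; rewrite rz => r1.
  exact: no_free_subalgebra hx hy r1 contains.
have [z eig rz] := spectral_radius_attained M isT.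
have [m le2] := exprn_ge2 r1.
(* The power z^m is an eigenvalue of M^m, of modulus at least 2. *)
apply: free_on_pair_contains (free m _); apply: le_trans le2 _.
rewrite -rz -normrX; apply: spectral_radius_ge.
by rewrite rmorphXn; apply: eigenvalueX.
Qed.
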